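(* Let $T$ be an operator semigroup on a set $D$, let $S$ be a $T$-space and let $B\subseteq S$. Let $\mathcal{T}_1$ be the topology on $S$ generated by the subbasis $\beta_1=\{S\setminus A: A\in\operatorname{Int}_T^{\operatorname{End}}(S/B)\}\cup\{S\}$. Let $P_1$ be the set of all topologies on $S$ for which $$\operatorname{Int}_T^{\operatorname{End}}(S/B)\setminus\{\emptyset\}=\{S': B\subseteq S'\le_q S,\ S'\text{ is closed and nonempty}\}, \qquad ( * )$$ and let $Q_1$ be the set of all topologies on $S$ which are finer than (i.e. contain) $\mathcal{T}_1$. Then $P_1\subseteq Q_1$ and the following statements are equivalent: (i) $P_1\neq\emptyset$. (ii) For all $S_1,S_2\in\operatorname{Int}_T^{\operatorname{End}}(S/B)$, $S_1\cup S_2\in\operatorname{Int}_T^{\operatorname{End}}(S/B)$. (Or equivalently, $\beta_1$ is a basis for $\mathcal{T}_1$.) (iii) $\operatorname{Int}_T^{\operatorname{End}}(S/B)$ is a $\vee$-sublattice of the lattice $\operatorname{Sub}_T(S)$. (iv) $\mathcal{T}_1\in P_1$ (where $P_1\subseteq Q_1$); that is, $\mathcal{T}_1$ is the coarsest topology on $S$ such that $( * )$ is satisfied.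
   Context: An operator semigroup on a set $D$ is a (possibly empty) set $T$ of functions $D\to D$ closed under composition. For $U\subseteq D$ put $\langle U\rangle_T=\{f(u): f\in T,\ u\in U\}$; a $T$-space is a subset of $D$ of the form $\langle U\rangle_T$. A subset $S\subseteq D$ is a quasi-$T$-space if $\langle S\rangle_T\subseteq S$; every $T$-space is a quasi-$T$-space. If $S'\subseteq S$ are both quasi-$T$-spaces, we write $S'\le_q S$ and call $S'$ a quasi-$T$-subspace of $S$. $\operatorname{Sub}_T(S)$ is the set of all quasi-$T$-subspaces of $S$, a lattice under inclusion with $S_1\wedge S_2=S_1\cap S_2$ and $S_1\vee S_2=S_1\cup S_2$. A $T$-morphism from a $T$-space $S$ to a $T$-space is a map $\sigma$ with $\sigma(f(a))=f(\sigma(a))$ for all $a\in S$, $f\in T$; $\operatorname{End}_T(S)$ is the set of $T$-morphisms from $S$ to itself. For $H\subseteq\operatorname{End}_T(S)$, $S^H=\{a\in S:\sigma(a)=a\ \forall\sigma\in H\}$, and $\operatorname{Int}_T^{\operatorname{End}}(S/B)=\{S^H: H\subseteq\operatorname{End}_T(S),\ B\subseteq S^H\}$ (a subset of $\operatorname{Sub}_T(S)$). A $\vee$-sublattice is a subset closed under binary joins of the ambient lattice. The topology generated by a subbasis is the collection of all unions of finite intersections of its members. *)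

(* Defs.v *)
From HB Require Import structures.
From mathcomp Require Import all_boot.
From mathcomp Require Import boolp classical_sets functions cardinality.
From mathcomp Require Import topology_structure.

Set Implicit Arguments.
Unset Strict Implicit.
Unset Printing Implicit Defensive.

Local Open Scope classical_set_scope.

Section OperatorSemigroups.
Variables (D : Type) (T : set (D -> D)).

Definition operator_semigroup : Prop :=
  forall f g : D -> D, T f -> T g -> T (f \o g).

Definition tspan (U : set D) : set D := [set f u | f in T & u in U].

Definition T_space (S : set D) : Prop := exists U : set D, S = tspan U.

Definition quasi_T_space (S : set D) : Prop := tspan S `<=` S.

Definition quasi_T_subspace (S' S : set D) : Prop :=
  [/\ quasi_T_space S', quasi_T_space S & S' `<=` S].

Definition SubT (S : set D) : set (set D) := [set S' | quasi_T_subspace S' S].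

(* A map from S to S' is represented by [{fun S >-> S'}], a total function on D
   sending S into S'. Its values outside S play no role: only its restriction
   to S is constrained here or used in [fixed] below, and every map from S to
   S' arises as such a restriction. *)
Definition T_morphism (S S' : set D) (sigma : {fun S >-> S'}) : Prop :=
  forall (a : D) (f : D -> D), S a -> T f -> sigma (f a) = f (sigma a).

Definition EndT (S : set D) : set {fun S >-> S} := [set sigma | T_morphism sigma].

End OperatorSemigroups.

Arguments EndT {D} T S.

Definition fixed (D : Type) (S : set D) (H : set {fun S >-> S}) : set D :=
  [set a | S a /\ forall sigma, H sigma -> sigma a = a].

Definition IntEnd (D : Type) (T : set (D -> D)) (S B : set D) : set (set D) :=
  [set fixed H | H in [set H : set {fun S >-> S} |
                        H `<=` EndT T S /\ B `<=` fixed H]].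

Section Joins.
Variable D : Type.
Implicit Types (L M : set (set D)) (A B J : set D).

(* Least upper bound in the family L ordered by inclusion. *)
Definition is_join L A B J : Prop :=
  [/\ L J, A `<=` J, B `<=` J &
      forall K, L K -> A `<=` K -> B `<=` K -> J `<=` K].

Definition join_sublattice L M : Prop :=
  M `<=` L /\ forall A B, M A -> M B -> exists2 J, is_join L A B J & M J.

Lemma is_join_SubT (T : set (D -> D)) (S A B J : set D) :
  SubT T S A -> SubT T S B -> is_join (SubT T S) A B J <-> J = A `|` B.
Proof.
move=> [qA qS AS] [qB _ BS].
have ST : SubT T S (A `|` B).
  split=> //; last by move=> x [/AS|/BS].
  by move=> _ [f Tf [u [Au|Bu] <-]]; [left; apply: qA|right; apply: qB];
    exists f => //; exists u.
split=> [[_ AJ BJ lub]|->].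
  apply/seteqP; split=> x; last by case=> [/AJ|/BJ].
  by apply: lub ST _ _ x => x; [left|right].
split=> [|x|x|K _ AK BK x]; [exact: ST|by left|by right|].
by case=> [/AK|/BK].
Qed.

End Joins.

(* A topology on a subset S of D is given by its family O of open sets, each of
   them a subset of S; see [is_topologyP] for the link with [topologicalType]. *)
Record is_topology (D : Type) (S : set D) (O : set (set D)) : Prop := {
  topology_sub : forall U, O U -> U `<=` S;
  topology_full : O S;
  topology_setI : forall U V, O U -> O V -> O (U `&` V);
  topology_bigcup : forall F : set (set D), F `<=` O -> O (\bigcup_(U in F) U)
}.

Lemma is_topologyP (D : Type) (S : set D) (O : set (set D)) :
  is_topology S O <->
  exists c : Topological (set_type S),
    O = [set set_val @` U | U in @open (Topological.Pack c)].
Proof.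
have imI (U V : set (set_type S)) :
    set_val @` (U `&` V) = (set_val @` U) `&` (set_val @` V).
  apply/seteqP; split=> [_ [x [Ux Vx] <-]|_ [[x Ux <-] [y Vy /val_inj yx]]].
    by split; exists x.
  by exists x => //; split=> //; rewrite -yx.
have imT : set_val @` [set: set_type S] = S.
  apply/seteqP; split=> [_ [x _ <-]|x Sx]; first exact: set_valP.
  by exists (SigSub (mem_set Sx)).
split=> [[Osub OT OI OU]|[c ->]].
- pose X0 : choiceType := HB.pack (set_type S) (gen_eqMixin (set_type S))
    (gen_choiceMixin (set_type S)).
  pose op : set (set X0) := [set V | O (set_val @` V)].
  have opT : op setT by rewrite /op/= imT.
  have opI : setI_closed op by move=> U V; rewrite /op/= imI; exact: OI.
  have opU (I : Type) (f : I -> set X0) :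
      (forall i, op (f i)) -> op (\bigcup_i f i).
    move=> Of; rewrite /op/= image_bigcup -(bigcup_image _ _ id).
    by apply: OU => _ [i _ <-]; exact: Of.
  pose X : topologicalType :=
    HB.pack (Choice.sort X0) X0 (@isOpenTopological.Build X0 op opT opI opU).
  exists (Topological.class X); apply/seteqP; split=> [U OpU|_ [V OV <-]].
    have UE : set_val @` (set_val @^-1` U : set (set_type S)) = U.
      apply/seteqP; split=> [|x Ux]; first exact: image_preimage_subset.
      by exists (SigSub (mem_set (Osub _ OpU _ Ux))).
    by exists (set_val @^-1` U) => //; rewrite /open/= /op/= UE.
  exact: OV.
- split.
  + by move=> _ [U _ <-] _ [x _ <-]; exact: set_valP.
  + by exists setT => //; exact: openT.
  + by move=> _ _ [U oU <-] [V oV <-]; exists (U `&` V); [exact: openI|].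
  + move=> F FO; pose X := Topological.Pack c.
    exists (\bigcup_(U in [set U : set X | open U /\
                             F [set set_val (x : set_type S) | x in U]]) U).
      by apply: bigcup_open => U [].
    rewrite image_bigcup; apply/seteqP; split=> [x [U [_ FU] Ux]|x [V FV Vx]].
      by exists [set set_val (x : set_type S) | x in U].
    have [U oU UV] := FO _ FV; exists U; first by split=> //; rewrite UV.
    by rewrite UV.
Qed.

Section GeneratedTopology.
Variables (D : Type) (S : set D).
Implicit Types (beta O : set (set D)).

(* The intersection with S makes the empty intersection equal to S. *)
Definition finite_intersections beta : set (set D) :=
  [set S `&` \bigcap_(U in G) U | G in [set G | finite_set G /\ G `<=` beta]].

Definition generated_topology beta : set (set D) :=
  [set \bigcup_(U in F) U | F in [set F | F `<=` finite_intersections beta]].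

Definition is_basis beta O : Prop :=
  beta `<=` O /\
  forall U, O U -> exists2 F : set (set D), F `<=` beta & U = \bigcup_(V in F) V.

Definition closed_in O (A : set D) : Prop := A `<=` S /\ O (S `\` A).

End GeneratedTopology.

Section TopologiesOnS.
Variables (D : Type) (T : set (D -> D)) (S B : set D).

Definition beta1 : set (set D) :=
  [set S `\` A | A in IntEnd T S B] `|` [set S].

Definition topology1 : set (set D) := generated_topology S beta1.

Definition P1 : set (set (set D)) :=
  [set O | is_topology S O /\
    IntEnd T S B `\` [set set0] =
    [set S' | [/\ B `<=` S', quasi_T_subspace T S' S,
                  closed_in S O S' & S' !=set0]]].

Definition Q1 : set (set (set D)) :=
  [set O | is_topology S O /\ topology1 `<=` O].

End TopologiesOnS.

(* Main.v *)
Require Import Defs.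
From mathcomp Require Import all_boot.
From mathcomp Require Import boolp classical_sets functions cardinality.

(** Complements turn statements on fixed sets into statements on open sets.
    A set [fixed H] is a quasi-T-subspace, and an intersection of such sets is
    again one, obtained by uniting the sets [H]; so the family of fixed sets
    is always closed under meets ([IntEnd_bigcap]), and only binary unions can
    fail.  The closed sets of a topology are stable under both operations, so
    the existence of a topology realizing the identity forces stability under
    unions.

    Conversely, stability under unions says that [beta1] is closed under
    binary intersections, hence is a basis of [topology1].  A closed set is
    then the intersection of S with fixed sets, and is itself a fixed set by
    [IntEnd_bigcap].  The only obstruction is the extra member S of
    [beta1], the complement of the empty set, which need not be a fixed set:
    it can occur in a union equal to the complement of A only if A is empty,
    which is why the identity is about nonempty sets
    ([IntEnd_of_closed_topology1]).  Any topology realizing the identity makes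
    the members of [beta1] open, so it contains [topology1], the coarsest
    topology that does so ([P1_sub_Q1]). *)

Set Implicit Arguments.
Unset Strict Implicit.
Unset Printing Implicit Defensive.

Local Open Scope classical_set_scope.

(** * Generated topologies *)

Section Generated.
Context {D : Type} {S : set D}.
Implicit Types (beta O F G : set (set D)) (U V W : set D).

(** The pointwise form of openness spares the choice of one family of finite
    intersections for each open set in a union. *)
Lemma generated_topologyP beta W :
  generated_topology S beta W <->
  forall x, W x -> exists2 V, finite_intersections S beta V & V x /\ V `<=` W.
Proof.
split=> [[F Ffin <-] x [V FV Vx]|WP].
  by exists V; [exact: Ffin|split=> // y Vy; exists V].
exists [set V | finite_intersections S beta V /\ V `<=` W]; first by move=> V [].
apply/seteqP; split=> [x [V [_ VW] Vx]|x Wx]; first exact: VW.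
by have [V Vfin [Vx VW]] := WP x Wx; exists V.
Qed.

Lemma finite_intersections_setI beta U V :
  finite_intersections S beta U -> finite_intersections S beta V ->
  finite_intersections S beta (U `&` V).
Proof.
move=> [G [Gfin Gb] <-] [G' [G'fin G'b] <-]; exists (G `|` G').
  by split; [rewrite finite_setU|move=> W [/Gb|/G'b]].
by rewrite bigcap_setU setIACA setIid.
Qed.

Lemma generated_is_topology beta : is_topology S (generated_topology S beta).
Proof.
split.
- by move=> U /generated_topologyP UP x /UP [_ [G _ <-] [[]]].
- apply/generated_topologyP => x Sx; exists S; last by split.
  exists set0; first by split=> //; exact: finite_set0.
  by rewrite bigcap_set0 setIT.
- move=> U V /generated_topologyP UP /generated_topologyP VP.
  apply/generated_topologyP => x [/UP [U' U'fin [U'x U'U]]].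
  move=> /VP [V' V'fin [V'x V'V]].
  exists (U' `&` V'); first exact: finite_intersections_setI.
  by split=> // y [/U'U Uy /V'V Vy].
- move=> F FO; apply/generated_topologyP => x [U FU Ux].
  have /generated_topologyP/(_ x Ux) [V Vfin [Vx VU]] := FO U FU.
  by exists V => //; split=> // y /VU Uy; exists U.
Qed.

Lemma sub_finite_intersections beta U :
  U `<=` S -> beta U -> finite_intersections S beta U.
Proof.
move=> US bU; exists [set U].
  by split=> [|_ ->//]; exact: finite_set1.
by rewrite bigcap_set1; apply/setIidPr.
Qed.

Lemma sub_generated_topology beta U :
  U `<=` S -> beta U -> generated_topology S beta U.
Proof.
move=> US bU; apply/generated_topologyP => x Ux.
by exists U; [exact: sub_finite_intersections|split].
Qed.

Lemma finite_intersections_sub beta O : O S ->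
  (forall U V, O U -> O V -> O (U `&` V)) ->
  beta `<=` O -> finite_intersections S beta `<=` O.
Proof.
move=> OS OI bO _ [_ [/finite_seqP [s ->] sb] <-].
elim: s sb => [|U s IHs] sb; first by rewrite set_nil bigcap_set0 setIT.
rewrite bigcap_seq big_cons -bigcap_seq setICA.
apply: OI; first by apply/bO/sb; rewrite /= mem_head.
by apply: IHs => V sV; apply: sb; rewrite /= in_cons (sV : V \in s) orbT.
Qed.

Lemma generated_topology_sub beta O :
  is_topology S O -> beta `<=` O -> generated_topology S beta `<=` O.
Proof.
move=> [_ OS OI OU] bO _ [F Ffin <-]; apply: OU => V /Ffin.
exact: finite_intersections_sub.
Qed.

Lemma is_basis_generated beta :
  (forall U, beta U -> U `<=` S) -> beta S ->
  (forall U V, beta U -> beta V -> beta (U `&` V)) ->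
  is_basis beta (generated_topology S beta).
Proof.
move=> bS betaS bI; split=> [U bU|_ [F Ffin <-]].
  by apply: sub_generated_topology => //; exact: bS.
by exists F => // V /Ffin; exact: finite_intersections_sub.
Qed.

Lemma closed_in_setU O U V : is_topology S O ->
  closed_in S O U -> closed_in S O V -> closed_in S O (U `|` V).
Proof.
move=> Otop [US OU] [VS OV]; split; first by rewrite subUset.
by rewrite setDUr; exact: (topology_setI Otop).
Qed.

End Generated.

(** * Fixed sets of T-morphisms *)

Section FixedSets.
Context {D : Type} {T : set (D -> D)} {S B : set D}.
Implicit Types (A : set D) (O F : set (set D)).

Lemma quasi_T_space_T_space :
  operator_semigroup T -> T_space T S -> quasi_T_space T S.
Proof.
move=> Tcomp [U ->] _ [f Tf [_ [g Tg [u Uu <-]] <-]].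
by exists (f \o g); [exact: Tcomp|exists u].
Qed.

Lemma quasi_T_space_setU A A' :
  quasi_T_space T A -> quasi_T_space T A' -> quasi_T_space T (A `|` A').
Proof.
move=> qA qA' _ [f Tf [u [Au|A'u] <-]].
  by left; apply: qA; exists f => //; exists u.
by right; apply: qA'; exists f => //; exists u.
Qed.

Lemma IntEnd_sub A : IntEnd T S B A -> A `<=` S.
Proof. by move=> [H _ <-] x []. Qed.

Lemma IntEnd_base A : IntEnd T S B A -> B `<=` A.
Proof. by move=> [H [_ BH] <-]. Qed.

(** A T-morphism fixing a also fixes every f a, since it commutes with f. *)
Lemma IntEnd_SubT : quasi_T_space T S -> IntEnd T S B `<=` SubT T S.
Proof.
move=> qS A IA; split=> //; last exact: IntEnd_sub.
case: IA => H [HE _] <- _ [f Tf [a [Sa aH] <-]].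
split=> [|sigma Hsigma]; first by apply: qS; exists f => //; exists a.
by rewrite (HE _ Hsigma a f Sa Tf) aH.
Qed.

(** Intersecting fixed sets amounts to uniting the sets of endomorphisms; the
    empty family gives S, the fixed set of the empty set of endomorphisms. *)
Lemma IntEnd_bigcap F : B `<=` S ->
  F `<=` IntEnd T S B -> IntEnd T S B (S `&` \bigcap_(A in F) A).
Proof.
move=> BS FI.
(* A member of F may be the fixed set of several H'; taking all of them
   avoids choosing one. *)
pose H : set {fun S >-> S} := [set sigma | exists H' : set {fun S >-> S},
  [/\ H' `<=` EndT T S, F (fixed H') & H' sigma]].
exists H; first split.
- by move=> sigma [H' [H'E _]]; exact: H'E.
- move=> b Bb; split=> [|sigma [H' [_ FH' H'sigma]]]; first exact: BS.
  by have [_] := IntEnd_base (FI _ FH') Bb; apply.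
apply/seteqP; split=> [a [Sa aH]|a [Sa aF]].
  split=> // A FA; have [H' [H'E _] AE] := FI A FA.
  rewrite -AE; split=> // sigma H'sigma; apply: aH.
  by exists H'; split=> //; rewrite AE.
by split=> // sigma [H' [_ /aF [_ aH'] H'sigma]]; exact: aH'.
Qed.

Lemma beta1_sub U : beta1 T S B U -> U `<=` S.
Proof. by move=> [[A _ <-] x []|->]. Qed.

Lemma IntEnd_closed_topology1 A :
  IntEnd T S B A -> closed_in S (topology1 T S B) A.
Proof.
move=> IA; split; first exact: IntEnd_sub.
apply: sub_generated_topology; first exact: subDsetl.
by left; exists A.
Qed.

(** The identity defining [P1] only speaks of nonempty fixed sets; the
    complement of the empty one is open in any topology. *)
Lemma P1_sub_Q1 : P1 T S B `<=` Q1 T S B.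
Proof.
move=> O [Otop OE]; split=> //; apply: generated_topology_sub => //.
move=> _ [[A IA <-]|->]; last exact: (topology_full Otop).
have [->|/eqP A0] := eqVneq A set0.
  by rewrite setD0; exact: (topology_full Otop).
have : (IntEnd T S B `\` [set set0]) A by [].
by rewrite OE => -[_ _ []].
Qed.

Lemma P1_setU O : P1 T S B O -> forall A A',
  IntEnd T S B A -> IntEnd T S B A' -> IntEnd T S B (A `|` A').
Proof.
move=> [Otop OE] A A' IA IA'.
have [->|/eqP A0] := eqVneq A set0; first by rewrite set0U.
have [->|/eqP A'0] := eqVneq A' set0; first by rewrite setU0.
have : (IntEnd T S B `\` [set set0]) A by [].
rewrite OE => -[BA [qA qS AS] Acl [a Aa]].
have : (IntEnd T S B `\` [set set0]) A' by [].
rewrite OE => -[_ [qA' _ A'S] A'cl _].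
suff : (IntEnd T S B `\` [set set0]) (A `|` A') by case.
rewrite OE; split.
- by move=> b /BA; left.
- by split=> //; [exact: quasi_T_space_setU|rewrite subUset].
- exact: closed_in_setU.
- by exists a; left.
Qed.

(** By De Morgan, stability of fixed sets under unions is stability of their
    complements under intersections. *)
Lemma is_basis_beta1 :
  (forall A A', IntEnd T S B A -> IntEnd T S B A' ->
     IntEnd T S B (A `|` A')) ->
  is_basis (beta1 T S B) (topology1 T S B).
Proof.
move=> IU; apply: is_basis_generated; [exact: beta1_sub|by right|].
move=> U V bU [[A' IA' <-]|->]; last first.
  by have /setIidPl -> := beta1_sub bU.
case: bU => [[A IA <-]|->].
  by left; exists (A `|` A'); [exact: IU|rewrite setDUr].
by left; exists A' => //; apply/esym/setIidPr; exact: subDsetl.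
Qed.

(** A nonempty closed set has a complement distinct from S, so the basic open
    sets that cover this complement are all complements of fixed sets. *)
Lemma IntEnd_of_closed_topology1 A : B `<=` S ->
  is_basis (beta1 T S B) (topology1 T S B) ->
  closed_in S (topology1 T S B) A -> A !=set0 -> IntEnd T S B A.
Proof.
move=> BS [_ basis] [AS /basis [F Fb AE]] [a Aa].
have -> : A = S `&` \bigcap_(A' in [set A' | IntEnd T S B A' /\ F (S `\` A')]) A'.
  apply/seteqP; split=> [x Ax|x [Sx xF]].
    split=> [|A' [_ FA']]; first exact: AS.
    apply: contrapT => A'x.
    have : (S `\` A) x by rewrite AE; exists (S `\` A') => //; split=> //; exact: AS.
    by case.
  apply: contrapT => nAx.
  have : (S `\` A) x by [].
  rewrite AE => -[V FV Vx]; case: (Fb V FV) => [[A' IA' VE]|VS].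
    by move: FV Vx; rewrite -VE => FV [_]; apply; apply: xF.
  have : (S `\` A) a by rewrite AE; exists V => //; rewrite VS; exact: AS.
  by case.
by apply: IntEnd_bigcap => // A' [].
Qed.

Lemma basis_IntEnd_setU : B `<=` S ->
  is_basis (beta1 T S B) (topology1 T S B) ->
  forall A A', IntEnd T S B A -> IntEnd T S B A' -> IntEnd T S B (A `|` A').
Proof.
move=> BS basis A A' IA IA'.
have [->|/set0P[a Aa]] := eqVneq A set0; first by rewrite set0U.
apply: IntEnd_of_closed_topology1 => //; last by exists a; left.
by apply: closed_in_setU; [exact: generated_is_topology|
  exact: IntEnd_closed_topology1|exact: IntEnd_closed_topology1].
Qed.

Lemma join_sublattice_IntEndP : quasi_T_space T S ->
  join_sublattice (SubT T S) (IntEnd T S B) <->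
  forall A A', IntEnd T S B A -> IntEnd T S B A' -> IntEnd T S B (A `|` A').
Proof.
move=> qS; have sub := IntEnd_SubT qS; split=> [[_ IJ] A A' IA IA'|IU].
  have [J Jjoin IntJ] := IJ A A' IA IA'.
  by move: Jjoin; rewrite is_join_SubT => [<-//||]; exact: sub.
split=> // A A' IA IA'; exists (A `|` A'); last exact: IU.
by rewrite is_join_SubT//; exact: sub.
Qed.

Lemma P1_topology1 : quasi_T_space T S -> B `<=` S ->
  is_basis (beta1 T S B) (topology1 T S B) -> P1 T S B (topology1 T S B).
Proof.
move=> qS BS basis; split; first exact: generated_is_topology.
apply/seteqP; split=> [A [IA /eqP/set0P A0]|A [BA qA Acl A0]].
  split=> //; [exact: IntEnd_base|exact: IntEnd_SubT|].
  exact: IntEnd_closed_topology1.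
by split; [exact: IntEnd_of_closed_topology1|exact/eqP/set0P].
Qed.

End FixedSets.

(** * The equivalence *)

Theorem theorem5p1p2 (D : Type) (T : set (D -> D)) (S B : set D)
    (hT : operator_semigroup T) (hS : T_space T S) (hB : B `<=` S) :
  P1 T S B `<=` Q1 T S B /\
  [<-> (* (i) *)
       P1 T S B !=set0;
       (* (ii) *)
       forall S1 S2 : set D, IntEnd T S B S1 -> IntEnd T S B S2 ->
         IntEnd T S B (S1 `|` S2);
       (* (ii), second form *)
       is_basis (beta1 T S B) (topology1 T S B);
       (* (iii) *)
       join_sublattice (SubT T S) (IntEnd T S B);
       (* (iv) *)
       P1 T S B (topology1 T S B);
       (* (iv), second form: the coarsest topology satisfying the identity *)
       P1 T S B (topology1 T S B) /\
         forall O : set (set D), P1 T S B O -> topology1 T S B `<=` O].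
Proof.
have qS := quasi_T_space_T_space hT hS.
split; first exact: P1_sub_Q1.
tfae.
- by move=> [O /P1_setU].
- exact: is_basis_beta1.
- by move=> basis; apply/(join_sublattice_IntEndP qS); exact: basis_IntEnd_setU.
- move=> /(join_sublattice_IntEndP qS)/is_basis_beta1; exact: P1_topology1.
- by move=> P1t; split=> // O /P1_sub_Q1 [].
- by move=> [P1t _]; exists (topology1 T S B).
Qed.
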